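(* Let $u\in\mathbb{R}^n$ have all entries positive, $\alpha_u>0$, $B_i\in\mathbb{R}^{n\times n}$, $c_i\in\mathbb{R}^n$, $d_i\in\mathbb{R}$. Let $x\in\mathbb{R}^n$ with $x\ge0$ and $\alpha_u\ge u^Tx$, and let $X$ be a symmetric $n\times n$ matrix. The HSOC valid inequality $$\begin{pmatrix}-\mathrm{diag}(u)\mathrm{diag}(x)&\mathrm{diag}(u)\mathrm{Diag}(B_iX)\\(\mathrm{Diag}(B_iX))^T\mathrm{diag}(u)&\alpha_u(c_i^Tx+d_i)\end{pmatrix}\preceq0$$ is dominated by the SOC-RLT constraints generated by $x\ge0$, $\alpha_u\ge u^Tx$ and $\|B_ix\|^2\le-c_i^Tx-d_i$; that is, it holds whenever $(x,X)$ satisfies, for $j=1,\dots,n$, $$\left\|\begin{pmatrix}B_iX_{\cdot,j}\\\tfrac12(x_j+c_i^TX_{\cdot,j}+d_ix_j)\end{pmatrix}\right\|\le\tfrac12(x_j-c_i^TX_{\cdot,j}-d_ix_j)$$ and $$\left\|\begin{pmatrix}\alpha_uB_ix-B_iXu\\\tfrac12\left(\alpha_u(1+c_i^Tx+d_i)-(1+d_i)u^Tx-u^TXc_i\right)\end{pmatrix}\right\|\le\tfrac12\left(\alpha_u(1-c_i^Tx-d_i)-(1-d_i)u^Tx+u^TXc_i\right).$$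
   Context: $\mathrm{diag}(v)$ is the diagonal matrix with diagonal $v$; $\mathrm{Diag}(A)$ is the column vector of the diagonal entries of a square matrix $A$; $X_{\cdot,j}$ is the $j$-th column of $X$; $\|\cdot\|$ is the Euclidean norm; $A\preceq0$ means $-A$ is positive semidefinite. The quadratic constraint is the convex constraint $x^TQ_ix+c_i^Tx+d_i\le0$ with $Q_i=B_i^TB_i$. A constraint is dominated by a set of constraints if it is implied by them. *)

(* Defs.v *)
From mathcomp Require Import all_boot all_order all_algebra.
From mathcomp Require Import reals.
Set Implicit Arguments.
Unset Strict Implicit.
Unset Printing Implicit Defensive.
Import Order.TTheory GRing.Theory Num.Theory.
Local Open Scope ring_scope.

Definition dotv (R : realType) (n : nat) (a b : 'cV[R]_n) : R :=
  (a^T *m b) 0 0.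

(* The library norm `|v| on matrices is the sup norm, hence this definition. *)
Definition norm2 (R : realType) (n : nat) (v : 'cV[R]_n) : R :=
  Num.sqrt (\sum_i v i 0 ^+ 2).

(* diag_mx takes a row vector. *)
Definition diagv (R : realType) (n : nat) (v : 'cV[R]_n) : 'M[R]_n :=
  diag_mx v^T.

Definition Diagv (R : realType) (n : nat) (A : 'M[R]_n) : 'cV[R]_n :=
  \col_i A i i.

Definition psdmx (R : realType) (n : nat) (A : 'M[R]_n) : Prop :=
  A \is symmetricmx /\ forall z : 'cV[R]_n, 0 <= dotv z (A *m z).

Definition nsdmx (R : realType) (n : nat) (A : 'M[R]_n) : Prop :=
  psdmx (- A).

(* Main.v *)
Require Import Defs.
From mathcomp Require Import all_boot all_order all_algebra.
From mathcomp Require Import reals ring lra.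
Set Implicit Arguments.
Unset Strict Implicit.
Unset Printing Implicit Defensive.
Import Order.TTheory GRing.Theory Num.Theory.
Local Open Scope ring_scope.

(** Each SOC-RLT constraint is a rotated cone in disguise: with
    [s] the linear factor it was generated from and [t] the linearization of
    [s * (- c^T x - d)], it says that [w] has squared norm at most [s * t] and
    that [s], [t] are nonnegative ([rotated_cone]).  For the constraint
    generated by [x_j >= 0] we have [s_j = x_j], [t_j = - c^T X_j - d x_j] and
    [w_j = B X_j], whose [j]-th entry is the [j]-th diagonal entry of [B X].
    So the 2 x 2 matrix with diagonal [x_j], [t_j] and off-diagonal entry
    [- (B X)_jj] is positive semidefinite.

    Multiply this matrix by [u_j], place it at rows and columns [j] and [n + 1],
    and sum over [j].  The result is the opposite of the HSOC matrix, except
    that its corner is [\sum_j u_j t_j] instead of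
    [- alpha (c^T x + d)].  The difference between the two corners is, by
    symmetry of [X], the factor [t_0] of the constraint generated by
    [u^T x <= alpha], which is nonnegative.  Lemma [nsdmx_arrow] is this
    decomposition of an arrow matrix into 2 x 2 blocks that share a corner. *)

Lemma dotvE (R : realType) (n : nat) (a b : 'cV[R]_n) :
  dotv a b = \sum_i a i 0 * b i 0.
Proof. by rewrite /dotv mxE; apply: eq_bigr => i _; rewrite mxE. Qed.

Lemma symmetricmxP (R : realType) (n : nat) (A : 'M[R]_n) :
  reflect (A^T = A) (A \is symmetricmx).
Proof.
rewrite is_hermitianmxE expr0 scale1r map_mx_id // eq_sym; exact: eqP.
Qed.

Lemma sqr_entry_le (R : realType) (n : nat) (v : 'cV[R]_n) (i : 'I_n) :
  v i 0 ^+ 2 <= \sum_k v k 0 ^+ 2.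
Proof.
by rewrite (bigD1 i) //= lerDl sumr_ge0 // => k _; exact: sqr_ge0.
Qed.

(** Squaring the norm bound gives [|w|^2 + ((s - t) / 2)^2 <= ((s + t) / 2)^2],
    that is, [|w|^2 <= s * t].  So [s] and [t] have a nonnegative product; their
    sum is nonnegative because it bounds a norm, hence so are both. *)
Lemma rotated_cone (R : realType) (n : nat) (w : 'cV[R]_n) (s t : R) :
  norm2 (col_mx w (2^-1 * (s - t))%:M) <= 2^-1 * (s + t) ->
  [/\ 0 <= s, 0 <= t & \sum_i w i 0 ^+ 2 <= s * t].
Proof.
move=> h.
have st_ge0 : 0 <= 2^-1 * (s + t) by apply: le_trans h; exact: sqrtr_ge0.
have {h} : \sum_i w i 0 ^+ 2 + (2^-1 * (s - t)) ^+ 2 <= (2^-1 * (s + t)) ^+ 2.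
  have -> : \sum_i w i 0 ^+ 2 + (2^-1 * (s - t)) ^+ 2
          = \sum_i (col_mx w (2^-1 * (s - t))%:M) i 0 ^+ 2.
    rewrite big_split_ord big_ord1 col_mxEd mxE eqxx mulr1n.
    by congr (_ + _); apply: eq_bigr => i _; rewrite col_mxEu.
  by rewrite -ler_sqrt ?sqr_ge0 // sqrtr_sqr (ger0_norm st_ge0).
have w_ge0 : 0 <= \sum_i w i 0 ^+ 2.
  by apply: sumr_ge0 => i _; exact: sqr_ge0.
move=> h.
have w_le : \sum_i w i 0 ^+ 2 <= s * t.
  have : (2^-1 * (s + t)) ^+ 2 = (2^-1 * (s - t)) ^+ 2 + s * t by field.
  lra.
have {}st_ge0 : 0 <= s + t by lra.
have {w_ge0} prod_ge0 : 0 <= s * t := le_trans w_ge0 w_le.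
by split=> //; nra.
Qed.

Lemma quadratic_form2_ge0 (R : realType) (s t b y e : R) :
  0 <= s -> 0 <= t -> b ^+ 2 <= s * t ->
  0 <= s * y ^+ 2 - 2 * (b * y * e) + t * e ^+ 2.
Proof.
rewrite le0r => /orP[/eqP-> t_ge0|s_gt0 _ b_le].
  rewrite mul0r => b2_le0.
  have /eqP -> : b == 0 by rewrite -sqrf_eq0 eq_le b2_le0 sqr_ge0.
  by rewrite !mul0r mulr0 subr0 add0r mulr_ge0 ?sqr_ge0.
(* completing the square in [y] *)
rewrite -(pmulr_rge0 _ s_gt0).
have -> : s * (s * y ^+ 2 - 2 * (b * y * e) + t * e ^+ 2)
        = (s * y - b * e) ^+ 2 + (s * t - b ^+ 2) * e ^+ 2 by ring.
by rewrite addr_ge0 ?sqr_ge0 // mulr_ge0 ?sqr_ge0 ?subr_ge0.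
Qed.

(** The corner [tau] is shared out among the 2 x 2 blocks, the [j]-th of which
    receives [t j]. *)
Lemma nsdmx_arrow (R : realType) (n : nat) (p v : 'cV[R]_n) (tau : R)
    (t : 'I_n -> R) :
  (forall j, 0 <= p j 0) -> (forall j, 0 <= t j) ->
  (forall j, v j 0 ^+ 2 <= p j 0 * t j) -> \sum_j t j <= tau ->
  nsdmx (block_mx (- diagv p) v v^T (- tau)%:M).
Proof.
move=> p_ge0 t_ge0 v_le t_le; split.
  apply/symmetricmxP; rewrite linearN /= tr_block_mx linearN /= tr_diag_mx.
  by rewrite trmxK tr_scalar_mx.
move=> z; rewrite -[z]vsubmxK [dsubmx z]mx11_scalar.
move: (usubmx z) (dsubmx z 0 0 : R) => y e.
have -> : dotv (col_mx y e%:M)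
     (- block_mx (- diagv p) v v^T (- tau)%:M *m col_mx y e%:M)
   = \sum_j (p j 0 * y j 0 ^+ 2 - 2 * (v j 0 * y j 0 * e) + t j * e ^+ 2)
     + (tau - \sum_j t j) * e ^+ 2.
  rewrite mulNmx mul_block_col opp_col_mx dotvE big_split_ord big_ord1.
  under eq_bigr => j _.
    rewrite !col_mxEu mulNmx opprD opprK mul_mx_scalar mxE mul_diag_mx !mxE.
    over.
  rewrite !col_mxEd mul_scalar_mx !mxE eqxx mulr1n.
  under [X in - (X + _)]eq_bigr => j _ do rewrite mxE.
  (* the cross terms come half from the rows of [y], half from the last row *)
  under [in RHS]eq_bigr => j _.
    rewrite (_ : _ + _ = y j 0 * (p j 0 * y j 0 - e * v j 0)
                         + (t j * e ^+ 2 - v j 0 * y j 0 * e)); last by ring.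
    over.
  by rewrite big_split sumrB -!mulr_suml /=; ring.
rewrite addr_ge0 //; last by rewrite mulr_ge0 ?sqr_ge0 ?subr_ge0.
apply: sumr_ge0 => j _.
exact: quadratic_form2_ge0.
Qed.

Theorem theorem3p2 (R : realType) (n : nat)
  (u : 'cV[R]_n) (alpha : R) (B : 'M[R]_n) (c : 'cV[R]_n) (d : R)
  (x : 'cV[R]_n) (X : 'M[R]_n)
  (u_gt0 : forall j, 0 < u j 0) (alpha_gt0 : 0 < alpha)
  (x_ge0 : forall j, 0 <= x j 0) (ux_le : dotv u x <= alpha)
  (X_sym : X \is symmetricmx)
  (soc_rlt_x : forall j : 'I_n,
     norm2 (col_mx (B *m col j X)
                   (2^-1 * (x j 0 + dotv c (col j X) + d * x j 0))%:M)
     <= 2^-1 * (x j 0 - dotv c (col j X) - d * x j 0))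
  (soc_rlt_u :
     norm2 (col_mx (alpha *: (B *m x) - B *m X *m u)
                   (2^-1 * (alpha * (1 + dotv c x + d) - (1 + d) * dotv u x
                            - dotv u (X *m c)))%:M)
     <= 2^-1 * (alpha * (1 - dotv c x - d) - (1 - d) * dotv u x
                + dotv u (X *m c))) :
  nsdmx (block_mx (- (diagv u *m diagv x)) (diagv u *m Diagv (B *m X))
                  ((Diagv (B *m X))^T *m diagv u) (alpha * (dotv c x + d))%:M).
Proof.
pose t j := - dotv c (col j X) - d * x j 0.
have cone_x j : [/\ 0 <= x j 0, 0 <= t j
    & \sum_i (B *m col j X) i 0 ^+ 2 <= x j 0 * t j].
  apply: rotated_cone.
  have -> : x j 0 - t j = x j 0 + dotv c (col j X) + d * x j 0.
    by rewrite /t; ring.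
  by rewrite /t addrA.
pose s0 := alpha - dotv u x.
pose t0 := - (alpha * (dotv c x + d)) + d * dotv u x + dotv u (X *m c).
have [_ t0_ge0 _] : [/\ 0 <= s0, 0 <= t0
    & \sum_i (alpha *: (B *m x) - B *m X *m u) i 0 ^+ 2 <= s0 * t0].
  apply: rotated_cone; rewrite /s0 /t0.
  set a := dotv c x in soc_rlt_u *; set b := dotv u x in soc_rlt_u *.
  set f := dotv u (X *m c) in soc_rlt_u *.
  have -> : alpha - b - (- (alpha * (a + d)) + d * b + f)
          = alpha * (1 + a + d) - (1 + d) * b - f by ring.
  have -> : alpha - b + (- (alpha * (a + d)) + d * b + f)
          = alpha * (1 - a - d) - (1 - d) * b + f by ring.
  exact: soc_rlt_u.
have sum_t : \sum_j u j 0 * t j = - (alpha * (dotv c x + d)) - t0.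
  have -> : - (alpha * (dotv c x + d)) - t0
          = - dotv u (X *m c) - d * dotv u x by rewrite /t0; ring.
  rewrite !dotvE mulr_sumr -!sumrN -big_split; apply: eq_bigr => j _ /=.
  have -> : (X *m c) j 0 = dotv c (col j X).
    rewrite dotvE mxE; apply: eq_bigr => k _; rewrite mulrC !mxE.
    by move/symmetricmxP: X_sym => {1}<-; rewrite mxE.
  by rewrite /t; ring.
pose p : 'cV[R]_n := \col_j (u j 0 * x j 0).
have -> : diagv u *m diagv x = diagv p.
  rewrite /diagv mulmx_diag; congr diag_mx.
  by apply/rowP => j; rewrite !mxE.
have -> : (Diagv (B *m X))^T *m diagv u = (diagv u *m Diagv (B *m X))^T.
  by rewrite trmx_mul tr_diag_mx.
rewrite -[alpha * _]opprK.
apply: (nsdmx_arrow (t := fun j => u j 0 * t j)) => [j|j|j|].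
- by rewrite mxE mulr_ge0 // ltW.
- by have [_ t_ge0 _] := cone_x j; rewrite mulr_ge0 // ltW.
- have [_ _ w_le] := cone_x j.
  have -> : (diagv u *m Diagv (B *m X)) j 0 = u j 0 * (B *m col j X) j 0.
    rewrite mul_diag_mx !mxE; congr (_ * _).
    by apply: eq_bigr => k _; rewrite mxE.
  rewrite [p j 0]mxE exprMn.
  have -> : u j 0 * x j 0 * (u j 0 * t j) = u j 0 ^+ 2 * (x j 0 * t j) by ring.
  by rewrite ler_wpM2l ?sqr_ge0 // (le_trans _ w_le) // sqr_entry_le.
- by rewrite sum_t lerBlDr lerDl.
Qed.
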